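(* Let $G$ be a finite simple connected planar graph on $n\ge 2$ vertices. Then $$\mathrm{dep}(G)>\frac13.$$
   Context: For a connected graph $G$, $\tau(G)$ is the number of spanning trees of $G$, and for $e\in E(G)$, $\tau_G(e)$ is the number of spanning trees of $G$ containing $e$. The spanning tree edge density of $e$ is $d_G(e)=\tau_G(e)/\tau(G)$, and the spanning tree edge dependence of $G$ is $\mathrm{dep}(G)=\max_{e\in E(G)}d_G(e)$. *)

(* Defs.v *)
From mathcomp Require Import all_boot all_order all_algebra.
From mathcomp Require Import all_classical all_reals all_analysis.

Set Implicit Arguments.
Unset Strict Implicit.
Unset Printing Implicit Defensive.

Import Order.TTheory GRing.Theory Num.Theory.
Import numFieldNormedType.Exports.

Local Open Scope ring_scope.

Record sgraph := SGraph {
  vertex :> finType;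
  adj : rel vertex;
  adj_sym : symmetric adj;
  adj_irr : irreflexive adj
}.

Section Graphs.
Variable G : sgraph.

Definition edges : {set {set G}} :=
  [set e : {set G} | [exists x, exists y, adj x y && (e == [set x; y]%SET)]]%SET.

Definition connected_graph : Prop := forall x y : G, connect (@adj G) x y.

(* Adjacency in the spanning subgraph (V(G), F), for F a set of edges. *)
Definition adj_in (F : {set {set G}}) : rel G :=
  fun x y => [set x; y]%SET \in F.

(* For F included in the edges of G, the relation adj_in F is irreflexive and
   symmetric, so cyclic walks without repeated vertices of length at most 2
   are degenerate and the cycles are those of length at least 3. *)
Definition acyclic (F : {set {set G}}) : Prop :=
  forall c : seq G, ucycle (adj_in F) c -> (size c < 3)%N.

Definition spanning_tree (F : {set {set G}}) : Prop :=
  [/\ F \subset edges,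
      forall x y : G, connect (adj_in F) x y
    & acyclic F].

Definition tau : nat := #|[pred F : {set {set G}} | `[< spanning_tree F >]]|.

Definition tau_edge (e : {set G}) : nat :=
  #|[pred F : {set {set G}} | `[< spanning_tree F >] && (e \in F)]|.

Definition density (e : {set G}) : rat := (tau_edge e)%:R / tau%:R.

(* Densities are nonnegative, so the default value 0 of the iterated maximum
   only matters when G has no edge. *)
Definition dep : rat := \big[Num.max/0]_(e in edges) density e.

(* Every edge e is drawn as a simple arc, the injective continuous image of
   [0, 1] under gamma e; its orientation is irrelevant. The last two clauses
   say that the interior of an arc contains no vertex and meets no other arc. *)
Definition plane_drawing (R : realType)
    (pos : G -> R * R) (gamma : {set G} -> R -> R * R) : Prop :=
  [/\ injective pos,
      forall x y : G, adj x y ->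
        let g := gamma [set x; y]%SET in
        (g 0 = pos x /\ g 1 = pos y) \/ (g 0 = pos y /\ g 1 = pos x),
      forall e, e \in edges ->
        {within [set` `[0, 1]%R], continuous (gamma e)}%classic /\
        {in `[0, 1]%R &, injective (gamma e)},
      forall e, e \in edges -> forall (t : R) (v : G),
        t \in `]0, 1[%R -> gamma e t <> pos v
    & forall e f, e \in edges -> f \in edges -> e != f ->
        {in `]0, 1[%R &, forall s t : R, gamma e s <> gamma f t}].

Definition planar (R : realType) : Prop :=
  exists pos gamma, @plane_drawing R pos gamma.

End Graphs.

(* Main.v *)
(* The densities of the edges add up to at least n - 1, because a spanning tree
   has n - 1 edges; so dep G <= 1/3 would force G to have at least 3n - 3 edges.
   By Mader's argument a graph with that many edges contracts onto K5.  Only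
   curves of edges without a common end have to be kept apart: these are
   disjoint compact sets, hence can be replaced by discrete curves with steps
   shorter than their mutual distances, and this weak kind of drawing survives
   contractions.  Finally K5 has no such drawing: joining consecutive points by
   L-shaped moves, the crossings of two curves are counted modulo 2 by winding
   numbers of each curve around the ends of the other, and the sum over the 15
   pairs of disjoint edges of K5 is odd (the van Kampen obstruction). *)

Require Import Defs.
From mathcomp Require Import all_boot all_order all_algebra.
From mathcomp Require Import all_classical all_reals all_analysis.
From mathcomp Require Import zify lra.
From Stdlib Require Import Btauto.
Import Order.TTheory GRing.Theory Num.Theory.
Import numFieldNormedType.Exports.

Set Implicit Arguments.
Unset Strict Implicit.
Unset Printing Implicit Defensive.

(** * Crossing and winding parities of discrete curves *)

Section ChainSum.
Variable P : Type.
Implicit Types (f g : P -> P -> bool) (a b : P) (s t : seq P).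

Fixpoint chain_sum f a s : bool :=
  if s is a' :: s' then f a a' (+) chain_sum f a' s' else false.

Lemma eq_chain_sum f g a s : f =2 g -> chain_sum f a s = chain_sum g a s.
Proof. by move=> fg; elim: s a => //= a' s IH a; rewrite fg IH. Qed.

Lemma chain_sumD f g a s :
  chain_sum (fun x y => f x y (+) g x y) a s
  = chain_sum f a s (+) chain_sum g a s.
Proof. by elim: s a => //= a' s IH a; rewrite IH addbACA. Qed.

Lemma chain_sum_telescope (h : P -> bool) a s :
  chain_sum (fun x y => h x (+) h y) a s = h a (+) h (last a s).
Proof.
elim: s a => [|a' s IH] a /=; first by rewrite addbb.
by rewrite IH addbA -[X in X (+) _]addbA addbb addbF.
Qed.

(* [X] and [Y] compare abscissas and ordinates. *)
Variables X Y : P -> P -> bool.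

(* Parity of the crossings of the moves from [a] to [a'] and from [b] to [b'],
   each of them made vertically first, then horizontally. *)
Definition step_cross a a' b b' : bool :=
  ((X a b (+) X a b') && (Y a b' (+) Y a' b'))
  (+) ((X a b (+) X a' b) && (Y a' b (+) Y a' b')).

Definition cross a s b t : bool :=
  chain_sum (fun a a' => chain_sum (step_cross a a') b t) a s.

(* Parity of the crossings of the curve [a :: s] with a horizontal ray from
   [b]; [cowind] is the same parity for [b :: t], [a] and the
   transposed orders. *)
Definition wind a s b : bool :=
  chain_sum (fun a a' => X a b && (Y a b (+) Y a' b)) a s.

Definition cowind b t a : bool :=
  chain_sum (fun b b' => X a b && (Y a b (+) Y a b')) b t.

(** For one pair of moves, [step_cross] is the difference of a [wind] term at [b] and [b'] plus that
    of a [cowind] term at [a] and [a']. Summed up, the former telescopes along [t], the latter along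
    [s]. *)
Lemma cross_wind a s b t :
  cross a s b t = (wind a s b (+) wind a s (last b t))
                  (+) (cowind b t a (+) cowind b t (last a s)).
Proof.
rewrite -chain_sumD -(chain_sum_telescope (cowind b t)) -chain_sumD.
apply: eq_chain_sum => {s} {}a a'.
pose h b0 := X a b0 && (Y a b0 (+) Y a' b0).
rewrite -(chain_sum_telescope h) -!chain_sumD.
apply: eq_chain_sum => {t} {}b b'; rewrite /step_cross /h.
case: (X a b); case: (X a' b); case: (X a b'); case: (Y a b); case: (Y a' b);
  by case: (Y a b'); case: (Y a' b').
Qed.

End ChainSum.

(** Swapping arguments complements [X] and preserves each sum of two [Y] values. This passes to the
    opposite ray; both rays together count every change of [Y] along the curve, which telescopes. *)
Lemma cowind_wind (P : eqType) (X Y : P -> P -> bool) (a b : P) (t : seq P) :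
  (forall x y, x != y -> X y x = ~~ X x y) ->
  (forall x y, x != y -> Y y x = ~~ Y x y) ->
  a \notin b :: t ->
  cowind X Y b t a = wind X Y b t a (+) (Y b a (+) Y (last b t) a).
Proof.
move=> XC YC; rewrite /cowind /wind -(chain_sum_telescope (fun b => Y b a)).
elim: t b => //= b' t IH b.
rewrite !inE !negb_or => /and3P[ab ab' at_].
rewrite IH ?inE ?negb_or ?ab' //.
rewrite (XC b a) ?(YC b a) ?(YC b' a) 1?eq_sym //.
move: (chain_sum _ _ _) (chain_sum _ _ _) => c1 c2.
by case: (X b a); case: (Y b a); case: (Y b' a); case: c1; case: c2.
Qed.

(** * No discrete drawing of K5 *)

Section Plane.
Local Open Scope ring_scope.
Variables (R : realDomainType) (delta : R).
Implicit Types (a b : R * R) (s t : seq (R * R)).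

(* Breaking ties lexicographically makes both orders total, which stands in for
   a general position assumption. *)
Definition lexlt a b := (a.1 < b.1) || ((a.1 == b.1) && (a.2 < b.2)).
Definition colexlt a b := lexlt (a.2, a.1) (b.2, b.1).

Lemma lexltC a b : a != b -> lexlt b a = ~~ lexlt a b.
Proof.
case: a b => [a1 a2] [b1 b2]; rewrite xpair_eqE /lexlt /= => ab.
by move: ab; case: (ltgtP a1 b1) => //= _; case: (ltgtP a2 b2).
Qed.

Lemma colexltC a b : a != b -> colexlt b a = ~~ colexlt a b.
Proof.
move=> ab; apply: lexltC; apply: contra ab.
by case: a b => [a1 a2] [b1 b2]; rewrite !xpair_eqE /= andbC.
Qed.

Definition nearby a b := (`|a.1 - b.1| < delta) && (`|a.2 - b.2| < delta).

Lemma nearby_sym : symmetric nearby.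
Proof. by move=> a b; rewrite /nearby distrC [`|a.2 - _|]distrC. Qed.

(** A comparison with [a] changes between [b] and [b'] only if the abscissa of [a] lies weakly
    between theirs. *)
Lemma lexlt_near a b b' : nearby b b' ->
  (lexlt a b != lexlt a b') || (lexlt b a != lexlt b' a) ->
  `|a.1 - b.1| < delta /\ `|a.1 - b'.1| < delta.
Proof.
move=> /andP[nbb _]; rewrite /lexlt => H.
have : (a.1 <= b.1 /\ b'.1 <= a.1) \/ (b.1 <= a.1 /\ a.1 <= b'.1).
  by move: H; case: (ltgtP a.1 b.1) => //=; case: (ltgtP a.1 b'.1) => //=; lra.
move: nbb; rewrite !ltr_norml; lra.
Qed.

Lemma colexlt_near a b b' : nearby b b' ->
  (colexlt a b != colexlt a b') || (colexlt b a != colexlt b' a) ->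
  `|a.2 - b.2| < delta /\ `|a.2 - b'.2| < delta.
Proof.
rewrite /nearby andbC => nbb.
exact: (@lexlt_near (a.2, a.1) (b.2, b.1) (b'.2, b'.1)).
Qed.

(** A nonzero first product puts [a] near [b']: its [lexlt] factor controls abscissas, its [colexlt]
    factor ordinates. A nonzero second product likewise puts [a'] near [b]. *)
Lemma step_cross_far a a' b b' : nearby a a' -> nearby b b' ->
  ~~ nearby a b' -> ~~ nearby a' b -> step_cross lexlt colexlt a a' b b' = false.
Proof.
move=> naa nbb; rewrite /nearby /step_cross => nab na'b.
have: ~~ (((lexlt a b != lexlt a b') && (colexlt a b' != colexlt a' b')) ||
  ((lexlt a b != lexlt a' b) && (colexlt a' b != colexlt a' b'))).
  apply/negP => /orP[] /andP[x y].
    case/negP: nab; apply/andP; split.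
      by case: (@lexlt_near a b b' nbb); rewrite ?x.
    by case: (@colexlt_near b' a a' naa); rewrite ?y ?orbT // distrC.
  case/negP: na'b; apply/andP; split.
    by case: (@lexlt_near b a a' naa); rewrite ?x ?orbT // => _; rewrite distrC.
  by case: (@colexlt_near a' b b' nbb); rewrite ?y.
by rewrite !negb_eqb negb_or => /andP[/negbTE-> /negbTE->].
Qed.

Definition far s t := {in s & t, forall a b, ~~ nearby a b}.

(** Far curves have crossing parity 0, so [cross_wind] relates winding parities; converting [cowind]
    to [wind] contributes the comparisons of ends. *)
Lemma far_wind a s b t : 0 < delta ->
  path nearby a s -> path nearby b t -> far (a :: s) (b :: t) ->
  let Y := colexlt in let W := wind lexlt Y in
  (W a s b (+) W a s (last b t)) (+) (W b t a (+) W b t (last a s))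
  = (Y a b (+) Y a (last b t)) (+) (Y (last a s) b (+) Y (last a s) (last b t)).
Proof.
move=> d0 sa tb ab Y W.
have nn x y : ~~ nearby x y -> x != y.
  by apply: contra => /eqP->; rewrite /nearby !subrr normr0 d0.
have cow x : x \in a :: s ->
    cowind lexlt Y b t x = W b t x (+) (Y x b (+) Y x (last b t)).
  move=> xs; rewrite cowind_wind; [|exact: lexltC|exact: colexltC|].
    by rewrite /Y !(@colexltC x) ?addNb ?addbN ?negbK // nn // ab // ?mem_last ?mem_head.
  by apply/negP => xt; have := ab x x xs xt; rewrite /nearby !subrr normr0 d0.
have: cross lexlt Y a s b t = false.
  rewrite /cross; elim: s a sa ab {cow} => //= a' s IH a /andP[aa' sa] ab.
  rewrite IH // ?addbF => [|x y xs yt]; last by rewrite ab // inE xs orbT.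
  elim: t b tb ab {IH} => //= b' t IH b /andP[bb' tb] ab.
  rewrite IH // ?addbF => [|x y xs yt]; last by rewrite ab // inE yt orbT.
  by rewrite step_cross_far //; apply: ab; rewrite !inE eqxx ?orbT.
rewrite cross_wind !cow ?mem_last ?mem_head //.
rewrite -!/(W _ _ _).
set w1 := W a s b; set w2 := W a s _; set w3 := W b t a; set w4 := W b t _.
set y1 := Y a b; set y2 := Y a _; set y3 := Y _ b; set y4 := Y _ _.
by move: w1 w2 w3 w4 y1 y2 y3 y4; do 8!case.
Qed.

(* Summing [far_wind] over the 15 pairs of disjoint edges of K5, every winding
   parity occurs twice, and the comparisons of the five points add up to 1. *)
Lemma no_K5_drawing (p : 'I_5 -> R * R) (c : 'I_5 -> 'I_5 -> seq (R * R)) :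
  0 < delta ->
  (forall i j, i != j -> path nearby (p i) (c i j) /\ last (p i) (c i j) = p j) ->
  ~ (forall i j k l, uniq [:: i; j; k; l] ->
       far (p i :: c i j) (p k :: c k l)).
Proof.
move=> d0 pc fc.
pose W i j k := wind lexlt colexlt (p i) (c i j) (p k).
pose Y i j := colexlt (p i) (p j).
have main i j k l : uniq [:: i; j; k; l] ->
   ((W i j k (+) W i j l) (+) (W k l i (+) W k l j))
    (+) ((Y i k (+) Y i l) (+) (Y j k (+) Y j l)) = false.
  move=> u; have := u; rewrite /= !inE !negb_or => /and4P[/and3P[ij _ _] _ kl _].
  have [pij lij] := pc _ _ ij; have [pkl lkl] := pc _ _ kl.
  have := @far_wind _ _ _ _ d0 pij pkl (fc _ _ _ _ u).
  by rewrite /= lij lkl -/(W _ _ _) -/(W _ _ _) => ->; rewrite addbb.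
have YC i j : i != j -> Y j i = ~~ Y i j.
  move=> ij; apply: colexltC; apply/eqP => pij.
  (* The points differ because [i k] and [j l] are disjoint edges, whose curves are far apart. *)
  have [k [l u]] : exists k l, uniq [:: i; k; j; l].
    have/card_gt1P[k [l [kk ll kl]]] : (1 < #|[set~ i] :\ j|)%N.
      have := cardsC1 i; rewrite (cardsD1 j) card_ord !inE eq_sym ij.
      by rewrite add1n => -[->].
    exists k, l; move: kk ll; rewrite /= !inE !negb_or ij kl.
    by rewrite ![i == _]eq_sym [j == l]eq_sym => /andP[-> ->] /andP[-> ->].
  have /negP[] := fc _ _ _ _ u (p i) (p j) (mem_head _ _) (mem_head _ _).
  by rewrite pij /nearby !subrr normr0 d0.
have : uniq [:: inord 0; inord 1; inord 2; inord 3; inord 4 : 'I_5].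
  by rewrite -(map_inj_uniq val_inj) /= !inordK.
move: (inord 0) (inord 1) (inord 2) (inord 3) (inord 4) => v0 v1 v2 v3 v4.
rewrite /= !inE !negb_or => u.
(* Once one of the five vertices is omitted, the other four split into two edges in three ways. *)
move: (main v0 v1 v2 v3) (main v0 v2 v1 v3) (main v0 v3 v1 v2)
  (main v0 v1 v2 v4) (main v0 v2 v1 v4) (main v0 v4 v1 v2)
  (main v0 v1 v3 v4) (main v0 v3 v1 v4) (main v0 v4 v1 v3)
  (main v0 v2 v3 v4) (main v0 v3 v2 v4) (main v0 v4 v2 v3)
  (main v1 v2 v3 v4) (main v1 v3 v2 v4) (main v1 v4 v2 v3).
case/and5P: u => /and4P[u01 u02 u03 u04] /and3P[u12 u13 u14] /andP[u23 u24] u34 _.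
rewrite /= !inE !negb_or ![v2 == v1]eq_sym ![v3 == v1]eq_sym ![v3 == v2]eq_sym.
rewrite ![v4 == v1]eq_sym ![v4 == v2]eq_sym ![v4 == v3]eq_sym.
rewrite u01 u02 u03 u04 u12 u13 u14 u23 u24 u34 /=.
rewrite (YC v1 v2) // (YC v1 v3) // (YC v1 v4) // (YC v2 v3) // (YC v2 v4) //.
rewrite (YC v3 v4) //.
have addb0 (x y : bool) : x = false -> y = false -> x (+) y = false.
  by move=> -> ->.
have addbE (x y : bool) : x (+) y = xorb x y by case: x; case: y.
move=> /(_ isT) h; do 14!move=> /(_ isT)/(addb0 _ _ h) {}h.
by have: true = false by rewrite -h !addbE; btauto.
Qed.
End Plane.

(** * Contraction of dense graphs onto K5 *)

Section Minors.
Variable T : finType.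
Implicit Types (e : rel T) (x y v : T) (K : {set T}).

(* Delete [v] and join [x] to every vertex of [K]; when [v] is adjacent to [x]
   and to all of [K], this is a minor, obtained by contracting [v] into [x]. *)
Definition reroute e v x K : rel T := fun u w =>
  [|| [&& e u w, u != v & w != v], (u == x) && (w \in K)
    | (w == x) && (u \in K)].

Lemma reroute_sym e v x K : symmetric e -> symmetric (reroute e v x K).
Proof.
by move=> es u w; rewrite /reroute es andbCA andbC -andbA orbCA orbC -orbA
  [X in [&& e _ _ & X]]andbC; case: (e w u) => //=; rewrite orbC orbA.
Qed.

Lemma reroute_irr e v x K :
  irreflexive e -> x \notin K -> irreflexive (reroute e v x K).
Proof.
move=> ei xK u; rewrite /reroute ei /= orbb.
by apply/andP => -[/eqP->]; apply/negP.
Qed.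

(** Ordered pairs count each edge twice, so a threshold of 3n - 3 edges becomes 6n - 6 arcs. *)
Definition arcs e := [set z : T * T | e z.1 z.2].

Lemma card_arcs e : #|arcs e| = \sum_x #|[set y | e x y]|.
Proof.
rewrite -sum1_card; under [RHS]eq_bigr do rewrite -sum1_card.
by rewrite pair_big_dep; apply: eq_big => -[x y]; rewrite !inE.
Qed.

(** Removing [v] loses its arcs in both directions; those between [x] and [K] are new, since [K]
    avoids the neighbours of [x]. *)
Lemma card_arcs_reroute e v x K : symmetric e -> irreflexive e ->
  K \subset [set y | e v y] -> x \notin K ->
  (forall k, k \in K -> ~~ e x k) -> (K != finset.set0 -> e v x) ->
  #|arcs (reroute e v x K)| + 2 * #|[set y | e v y]| = #|arcs e| + 2 * #|K|.
Proof.
move=> es ei /fintype.subsetP KN xK xKe vx.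
set N := [set y | e v y].
pose old := [set z in arcs e | (z.1 != v) && (z.2 != v)].
have dE : arcs e = old :|: finset.setX [set v] N :|: finset.setX N [set v].
  apply/finset.setP=> -[a b]; rewrite !inE /=.
  have [->|_] := eqVneq a v; have [->|_] := eqVneq b v;
    rewrite ?ei ?andbF ?andbT ?orbF //= es //.
have dE' : arcs (reroute e v x K) =
    old :|: finset.setX [set x] K :|: finset.setX K [set x].
  by apply/finset.setP=> -[a b]; rewrite !inE /reroute /= -orbA [(b == x) && _]andbC.
have disjU (A B C : {set T * T}) : [disjoint A & B] -> [disjoint A & C] ->
    [disjoint B & C] -> #|A :|: B :|: C| = #|A| + #|B| + #|C|.
  move=> AB AC BC; rewrite cardsU (_ : _ :&: C = finset.set0) ?cards0 ?subn0.
    by rewrite cardsU disjoint_setI0 ?cards0 ?subn0.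
  by rewrite finset.setIUl !disjoint_setI0 ?finset.setU0.
rewrite dE dE' !disjU ?cardsX ?cards1; first by lia.
all: rewrite -finset.setI_eq0; apply/eqP/finset.setP=> -[a b]; rewrite !inE /=.
- by case: eqP => //= _; rewrite andbF.
- by case: (b =P v) => //= _; rewrite !andbF.
- by case: (a =P v) => //= ->; rewrite ei andbF.
- case: (a =P x) => //= [->|]; rewrite ?andbF //.
  by case: (boolP (b \in K)) => [/xKe/negbTE->//|]; rewrite ?andbF.
- case: (b =P x) => //= [->|]; rewrite ?andbF // es.
  by case: (boolP (a \in K)) => [/xKe/negbTE->//|]; rewrite ?andbF.
- by case: (a =P x) => //= ->; rewrite (negbTE xK) andbF.
Qed.

Definition clique5 e := exists s : seq T,
  [/\ size s = 5, uniq s & {in s &, forall x y, x != y -> e x y}].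

Lemma clique5_cons e a b c d f : symmetric e -> uniq [:: a; b; c; d; f] ->
  all (e a) [:: b; c; d; f] -> all (e b) [:: c; d; f] -> all (e c) [:: d; f] ->
  e d f -> clique5 e.
Proof.
move=> es u /and5P[ab ac ad af _] /and4P[bc bd bf _] /and3P[cd cf _] df.
exists [:: a; b; c; d; f]; split=> // x y; rewrite !inE.
by move=> /or4P[/eqP->|/eqP->|/eqP->|/orP[]/eqP->]
  /or4P[/eqP->|/eqP->|/eqP->|/orP[]/eqP->]; rewrite ?eqxx // es.
Qed.

(* Mader's argument: once surplus edges are deleted, some [v] has at most 5
   neighbours.  Contracting [v] into a neighbour [x] keeps the graph dense unless
   [x] misses fewer than [#|N(v)| - 3] of the other neighbours.  If this never
   applies, the neighbourhood of [v] is K4, or contains a wheel on 5 vertices. *)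
Lemma dense_clique5 (Q : rel T -> Prop) :
  (forall e e', subrel e' e -> Q e -> Q e') ->
  (forall e v x K, symmetric e -> irreflexive e -> e v x ->
     K \subset [set y | e v y] -> x \notin K -> Q e -> Q (reroute e v x K)) ->
  forall (S : {set T}) e, symmetric e -> irreflexive e ->
    (forall x y, e x y -> x \in S) -> Q e ->
    2 <= #|S| -> 6 * #|S| <= #|arcs e| + 6 ->
  exists e', [/\ symmetric e', Q e' & clique5 e'].
Proof.
move=> Qsub Qrer S e.
have [n] := ubnP (#|S| + #|arcs e|).
elim: n S e => // n IH S e ltn es ei eS Qe S2 Se.
(* With two arcs above the threshold, an edge can be deleted. Otherwise the average degree is below
   6. *)
have [Se2|Se2] := leqP (6 * #|S| + 2) (#|arcs e| + 6).
  have /card_gt0P[[x y]] : 0 < #|arcs e| by lia.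
  rewrite inE /= => xy.
  pose e' u w := e u w && ~~ ((u == x) && (w == y) || (u == y) && (w == x)).
  have yx : (y, x) != (x, y).
    by apply: contraTneq xy => -[->]; rewrite ei.
  have arcsE : arcs e' = arcs e :\ (x, y) :\ (y, x).
    apply/finset.setP=> -[a b].
    by rewrite !inE /e' /= !xpair_eqE negb_or andbC -andbA andbCA.
  have card_e : #|arcs e| = #|arcs e'| + 2.
    rewrite arcsE (cardsD1 (x, y)) (cardsD1 (y, x) (_ :\ _)) !inE /= yx xy es xy.
    by lia.
  apply: (IH S e'); try lia.
  - by move=> u w; rewrite /e' es orbC ![(w == _) && _]andbC.
  - by move=> u; rewrite /e' ei.
  - by move=> u w /andP[/eS].
  - by apply: Qsub Qe => u w /andP[].
have [v vS dv] : exists2 v, v \in S & #|[set y | e v y]| < 6.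
  apply/exists_inP; apply: contraTT isT; rewrite negb_exists_in => /forall_inP dS.
  have : \sum_(x in S) 6 <= \sum_(x in S) #|[set y | e x y]|.
    by apply: leq_sum => x /dS; rewrite -leqNgt.
  rewrite sum_nat_const; suff <- : #|arcs e| = \sum_(x in S) #|[set y | e x y]| by lia.
  rewrite card_arcs (bigID (mem S)) /= [X in _ + X]big1 ?addn0 // => x xS.
  by apply: eq_card0 => y; rewrite inE; apply: contraNF xS => /eS.
set N := [set y | e v y] in dv.
(* Two vertices give at most 4 ordered pairs, fewer than the 6 arcs required; so [S :\ v] keeps two
   elements. *)
have S3 : 2 < #|S|.
  have sub : arcs e \subset finset.setX S S.
    by apply/fintype.subsetP=> -[a b]; rewrite !inE /= => ab; rewrite (eS _ _ ab) (eS b a) // es.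
  by have := subset_leq_card sub; rewrite cardsX; nia.
have S1 : #|S| = #|S :\ v| + 1 by rewrite (cardsD1 v) vS addnC.
(* Losing a vertex lowers the threshold by 6, and rerouting loses twice [#|N| - #|K|] arcs, hence at
   most 6. *)
have step x K : K \subset N -> x \notin K -> (forall k, k \in K -> ~~ e x k) ->
    (K != finset.set0 -> e v x) -> Q (reroute e v x K) -> #|N| <= 3 + #|K| ->
    exists e', [/\ symmetric e', Q e' & clique5 e'].
  move=> KN xK xKe vx QK NK.
  have cE := card_arcs_reroute es ei KN xK xKe vx; rewrite -/N in cE.
  have KN' := subset_leq_card KN.
  apply: (IH (S :\ v) (reroute e v x K)); try lia; try by [].
  - exact: reroute_sym.
  - exact: reroute_irr.
  - move=> a b /or3P[/and3P[/eS aS av _]|/andP[/eqP-> bK]|/andP[_ aK]].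
    + by rewrite !inE av.
    + have K0 : K != finset.set0 by apply/finset.set0Pn; exists b.
      by have := vx K0; rewrite !inE es => xv; rewrite (eS _ _ xv) andbT;
        apply: contraTneq xv => ->; rewrite ei.
    + have := fintype.subsetP KN _ aK; rewrite !inE es => xv; rewrite (eS _ _ xv) andbT.
      by apply: contraTneq xv => ->; rewrite ei.
have [N3|N4] := leqP #|N| 3.
  apply: (step v finset.set0); rewrite ?finset.sub0set ?inE ?eqxx ?cards0 //.
  - by move=> k; rewrite inE.
  - by apply: Qsub Qe => a b; rewrite /reroute !inE !andbF !orbF => /andP[].
pose miss x := [set y in N | (y != x) && ~~ e x y].
have [/existsP[x /andP[xN mx]]|] := boolP [exists x, (x \in N) && (#|N| <= 3 + #|miss x|)].
  have vx : e v x by rewrite inE in xN.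
  have mN : miss x \subset N by apply/fintype.subsetP=> y; rewrite inE => /andP[].
  have xm : x \notin miss x by rewrite !inE eqxx andbF.
  by apply: (step x (miss x)) => // [k|]; [rewrite !inE => /and3P[]|exact: Qrer].
rewrite negb_exists => /forallP few.
have ev x : x \in N -> e v x by rewrite inE.
(* By [few], four neighbours are pairwise adjacent and form K5 with [v]; among five, each misses at
   most one other. *)
have [N5|N5] := ltnP #|N| 5.
  have eN : {in N &, forall x y, x != y -> e x y}.
    move=> x y xN yN xy; apply: contraT => nxy; have := few x; rewrite xN /=.
    suff -> : #|N| <= 3 + #|miss x| by [].
    have : 0 < #|miss x| by apply/card_gt0P; exists y; rewrite inE yN eq_sym xy.
    by lia.
  exists e; split=> //; exists (v :: enum N); split.
  - by rewrite /= -cardE; lia.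
  - by rewrite /= mem_enum inE ei enum_uniq.
  - move=> x y; rewrite !inE !mem_enum.
    move=> /predU1P[->|xN] /predU1P[->|yN]; rewrite ?eqxx // => xy.
    + exact: ev.
    + by rewrite es ev.
    + exact: eN.
have {}N5 : #|N| = 5 by lia.
have two x y z : x \in N -> y \in N -> z \in N -> x != y -> x != z -> y != z ->
    ~~ e x y -> e x z.
  move=> xN yN zN xy xz yz nxy; apply: contraT => nxz; have := few x.
  rewrite xN /=; suff -> : #|N| <= 3 + #|miss x| by [].
  have /subset_leq_card : [set y; z] \subset miss x.
    apply/fintype.subsetP=> t; rewrite !inE => /orP[]/eqP->.
      by rewrite -!topredE /= in yN *; rewrite ev // eq_sym xy.
    by rewrite ev // eq_sym xz.
  by rewrite cards2 yz; lia.
have [/existsP[a /existsP[b /and4P[aN bN ab nab]]]|] :=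
  boolP [exists a, exists b, [&& a \in N, b \in N, a != b & ~~ e a b]]; last first.
  rewrite negb_exists => /forallP H; exists e; split=> //; exists (enum N).
  split; rewrite -?cardE ?enum_uniq // => x y; rewrite !mem_enum => xN yN xy.
  by have := H x; rewrite negb_exists => /forallP /(_ y); rewrite xN yN xy /= negbK.
have vN : v \notin N by rewrite inE ei.
have nv x : x \in N -> v != x by move=> xN; apply: contraNneq vN => ->.
(* Given a second missing pair [c d], contracting [c] into [a] supplies the missing edge [a b], and
   [v], [a], [b], [d], [f] form a clique. *)
have main c d f : uniq [:: a; b; c; d; f] -> {subset [:: c; d; f] <= N} ->
    ~~ e c d -> exists e', [/\ symmetric e', Q e' & clique5 e'].
  rewrite /= !inE !negb_or => /and5P[/and4P[_ ac ad af] /and3P[bc bd bf]].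
  move=> /andP[cd cf] df _ cdfN ncd.
  have cN : c \in N by apply: cdfN; rewrite !inE eqxx.
  have dN : d \in N by apply: cdfN; rewrite !inE eqxx orbT.
  have fN : f \in N by apply: cdfN; rewrite !inE eqxx !orbT.
  have nba : ~~ e b a by rewrite es.
  have ba : b != a by rewrite eq_sym.
  have ndc : ~~ e d c by rewrite es.
  have dc : d != c by rewrite eq_sym.
  exists (reroute e c a [set b]); split; first exact: reroute_sym.
    apply: Qrer => //; rewrite ?inE //.
    - by rewrite es (two a b c).
    - by apply/fintype.subsetP=> t; rewrite !inE => /eqP->; rewrite es (two b a c).
  have vc : v != c by apply: contraTneq cN => <-; rewrite inE ei.
  have r x y : e x y -> x != c -> y != c -> reroute e c a [set b] x y.
    by move=> xy xc yc; rewrite /reroute xy xc yc.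
  apply: (@clique5_cons _ v a b d f); first exact: reroute_sym.
  - by rewrite /= !inE !negb_or !nv // ab ad af bd bf df.
  - by rewrite /= !r ?ev // eq_sym.
  - have ead : e a d by apply: (two a b d).
    have eaf : e a f by apply: (two a b f).
    apply/and4P; split=> //; [|by apply: r; rewrite // eq_sym..].
    by rewrite /reroute !inE !eqxx orbT.
  - have ebd : e b d by apply: (two b a d).
    have ebf : e b f by apply: (two b a f).
    by rewrite /= !r ?andbT // eq_sym.
  - have edf : e d f by apply: (two d c f).
    by rewrite r // eq_sym.
have : #|N :\ a :\ b| = 3.
  have := cardsD1 a N; have := cardsD1 b (N :\ a).
  by rewrite !inE [b == a]eq_sym ab (ev _ aN) (ev _ bN) N5; lia.
rewrite cardE; have := enum_uniq (N :\ a :\ b).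
have : {subset enum (N :\ a :\ b) <= N :\ a :\ b} by move=> x; rewrite mem_enum.
case: (enum _) => [|c [|d [|f []]]] // sub u _.
have cdfN : {subset [:: c; d; f] <= N}.
  by move=> x /sub; rewrite !inE => /and3P[].
have [nac nbc] : (c != a) /\ (c != b).
  by have := sub c (mem_head _ _); rewrite !inE => /and3P[-> ->].
have [nad nbd] : (d != a) /\ (d != b).
  by have := sub d; rewrite !inE eqxx orbT => /(_ isT)/and3P[-> ->].
have [naf nbf] : (f != a) /\ (f != b).
  by have := sub f; rewrite !inE eqxx !orbT => /(_ isT)/and3P[-> ->].
have [cN dN fN] : [/\ c \in N, d \in N & f \in N].
  by split; apply: cdfN; rewrite !inE eqxx ?orbT.
move: u; rewrite /= !inE !negb_or andbT => /andP[/andP[cd cf] df].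
have [ecd|ncd] := boolP (e c d); last first.
  apply: (main c d f) => //.
  by rewrite /= !inE !negb_or ab ![a == _]eq_sym ![b == _]eq_sym nac nad naf
    nbc nbd nbf cd cf df.
have [ecf|ncf] := boolP (e c f); last first.
  apply: (main c f d) => // [|x]; last by rewrite !inE => /or3P[]/eqP->; apply: ev.
  by rewrite /= !inE !negb_or ab ![a == _]eq_sym ![b == _]eq_sym nac nad naf
    nbc nbd nbf cd cf eq_sym df.
have [edf|ndf] := boolP (e d f); last first.
  apply: (main d f c) => // [|x]; last by rewrite !inE => /or3P[]/eqP->; apply: ev.
  by rewrite /= !inE !negb_or ab ![a == _]eq_sym ![b == _]eq_sym nac nad naf
    nbc nbd nbf df ![_ == c]eq_sym cd cf.
have ea x : x \in N -> x != a -> x != b -> e a x.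
  by move=> xN xa xb; apply: (two a b x); rewrite // eq_sym.
(* Now [a b] is the only missing pair in [N], so leaving out [b] yields K5. *)
exists e; split=> //; apply: (@clique5_cons _ v a c d f) => //.
- by rewrite /= !inE !negb_or !nv // ![a == _]eq_sym nac nad naf cd cf df.
- by rewrite /= !ev.
- by rewrite /= !ea.
- by rewrite /= ecd ecf.
Qed.
End Minors.

(** * Discrete drawings under contraction *)

Section Drawable.
Local Open Scope ring_scope.
Variables (R : realDomainType) (delta : R) (T : finType).
Implicit Types (e : rel T).

(* A drawing up to scale [delta]: edges are discrete curves, and only the
   curves of two edges without a common end are kept apart, which makes the
   notion stable under contraction. *)
Definition drawable e := exists (p : T -> R * R) (c : T -> T -> seq (R * R)),
  (forall x y, e x y -> path (nearby delta) (p x) (c x y) /\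
                        last (p x) (c x y) = p y) /\
  (forall x y z t, e x y -> e z t -> x != z -> x != t -> y != z -> y != t ->
     far delta (p x :: c x y) (p z :: c z t)).

Lemma drawable_sub e e' : subrel e' e -> drawable e -> drawable e'.
Proof.
move=> sub [p [c [pc fc]]]; exists p, c; split=> [x y /sub/pc//|x y z t xy zt].
by apply: fc; apply: sub.
Qed.

(** A new edge is drawn through [v] by concatenating two old curves. All new edges contain [x], so
    two of them are never compared; a kept edge avoids [v], hence is disjoint from both pieces when
    it avoids the ends of the new edge. *)
Lemma drawable_reroute e v x (K : {set T}) : symmetric e -> irreflexive e ->
  e v x -> K \subset [set y | e v y] -> x \notin K ->
  drawable e -> drawable (reroute e v x K).
Proof.
move=> es ei vx /fintype.subsetP KN xK [p [c [pc fc]]].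
have xv : e x v by rewrite es.
have vK k : k \in K -> e v k by move=> /KN; rewrite inE.
pose c' u w := if [&& e u w, u != v & w != v] then c u w
               else c u v ++ c v w.
have e'P u w : reroute e v x K u w -> [/\ u != v, w != v &
    ~~ [&& e u w, u != v & w != v] -> [/\ e u v, e v w & x \in [:: u; w]]].
  have nv y : e v y -> y != v by apply: contraTneq => ->; rewrite ei.
  move=> /or3P[uw|/andP[/eqP-> wK]|/andP[/eqP-> uK]].
  - by rewrite uw; case/and3P: uw.
  - split; [exact: nv|exact/nv/vK|move=> _].
    by split; [|exact: vK|exact: mem_head].
  - split; [exact/nv/vK|exact: nv|move=> _].
    by split; [rewrite es; exact: vK| |rewrite !inE eqxx orbT].
have ptP u w a : reroute e v x K u w -> a \in p u :: c' u w ->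
    exists u1 w1, [/\ e u1 w1, a \in p u1 :: c u1 w1 &
      forall y, y \in [:: u1; w1] ->
        (y \in [:: u; w]) || ((y == v) && (x \in [:: u; w]))].
  move=> /e'P[uv wv H]; rewrite /c'; case: ifPn => [/andP[uw _] a_|/H[euv evw xuw]].
    by exists u, w; split=> // y ->.
  rewrite -cat_cons mem_cat => /orP[a_|a_].
    exists u, v; split=> // y; rewrite xuw andbT !inE.
    by case/orP=> ->; rewrite ?orbT.
  exists v, w; split=> [//||y]; first by rewrite inE a_ orbT.
  by rewrite xuw andbT !inE; case/orP=> ->; rewrite ?orbT.
exists p, c'; split=> [u w /e'P[uv wv H]|u w z t uw zt uz ut wz wt a b aP bP].
  rewrite /c'; case: ifPn => [/andP[/pc]//|/H[/pc[p1 l1] /pc[p2 l2] _]].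
  by rewrite cat_path last_cat l1 p1 p2.
have [uv wv _] := e'P _ _ uw; have [zv tv _] := e'P _ _ zt.
have [u1 [w1 [e1 a1 s1]]] := ptP _ _ _ uw aP.
have [z1 [t1 [e2 b1 s2]]] := ptP _ _ _ zt bP.
have disj : forall y, y \in [:: u; w] -> y \notin [:: z; t].
  by move=> y; rewrite !inE => /orP[]/eqP->; rewrite negb_or ?uz ?ut ?wz ?wt.
have ne y y' : y \in [:: u1; w1] -> y' \in [:: z1; t1] -> y != y'.
  move=> /s1 H1 /s2 H2; apply/eqP => yy; rewrite -{}yy in H2.
  case/orP: H1 => [y1|/andP[/eqP yv x1]]; case/orP: H2 => [y2|/andP[/eqP yv' x2]].
  - by move: (disj _ y1); rewrite y2.
  - by move: y1; rewrite yv' !inE ![v == _]eq_sym (negbTE uv) (negbTE wv).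
  - by move: y2; rewrite yv !inE ![v == _]eq_sym (negbTE zv) (negbTE tv).
  - by move: (disj _ x1); rewrite x2.
by apply: (fc u1 w1 z1 t1) => //; apply: ne; rewrite !inE eqxx ?orbT.
Qed.

Lemma not_drawable_clique5 e : 0 < delta -> drawable e -> ~ clique5 e.
Proof.
move=> d0 [p [c [pc fc]]] [s [s5 us es]].
have [x0 _] : exists x0, x0 \in s.
  by case: s s5 {us es} => // x s _; exists x; exact: mem_head.
pose v (i : 'I_5) := nth x0 s i.
have ev i j : i != j -> e (v i) (v j).
  by move=> ij; apply: es; rewrite ?mem_nth ?s5 // nth_uniq ?s5.
have vv i j : i != j -> v i != v j by move=> ij; rewrite nth_uniq ?s5.
apply: (@no_K5_drawing R delta (p \o v) (fun i j => c (v i) (v j))) => //.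
  by move=> i j /ev/pc.
move=> i j k l; rewrite /= !inE !negb_or => /and4P[/and3P[ij ik il] /andP[jk jl] kl _].
by apply: fc; rewrite ?ev ?vv.
Qed.

Lemma drawable_sparse e (S : {set T}) : 0 < delta -> symmetric e -> irreflexive e ->
  (forall x y, e x y -> x \in S) -> (2 <= #|S|)%N -> drawable e ->
  (#|arcs e| + 6 < 6 * #|S|)%N.
Proof.
move=> d0 es ei eS S2 de; rewrite ltnNge; apply/negP => Se.
have [|e' [_ /(not_drawable_clique5 d0)]//] :=
  @dense_clique5 _ drawable _ drawable_reroute _ _ es ei eS de S2 Se.
by move=> e1 e2; exact: drawable_sub.
Qed.
End Drawable.

(** * From continuous arcs to discrete curves *)

Lemma adj_edges (G : sgraph) (x y : G) : adj x y -> [set x; y]%SET \in edges G.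
Proof.
by move=> xy; rewrite inE; apply/existsP; exists x; apply/existsP; exists y;
  rewrite xy eqxx.
Qed.

Section Curves.
Local Open Scope ring_scope.
Local Open Scope classical_set_scope.
Variable R : realType.
Implicit Types (A B : set (R * R)) (a b : R * R).

Lemma nearby_ball delta a b : nearby delta a b <-> ball a delta b.
Proof. by split=> [/andP[]|[??]]; [split|apply/andP]. Qed.

(** The maximum-norm distance attains a minimum on the compact product, if nonempty, and
    disjointness makes it positive. *)
Lemma compact_far A B : compact A -> compact B -> A `&` B = set0 ->
  exists2 delta, 0 < delta & forall a b, A a -> B b -> ~~ nearby delta a b.
Proof.
move=> cA cB AB0.
have [[[a b] [/= Aa Bb]]|AB] := pselect ((A `*` B) !=set0); last first.
  by exists 1 => // a b Aa Bb; exfalso; apply: AB; exists (a, b).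
pose f (z : (R * R) * (R * R)) : R := `|z.1 - z.2|.
have cf : {within A `*` B, continuous f}.
  apply: continuous_subspaceT => z.
  apply: (@cvg_norm R (R * R)%type).
  apply: cvgB; [exact: cvg_fst|exact: cvg_snd].
have [||[a0 b0]] := compact_EVT_min _ _ cf; [by exists (a, b)|exact: compact_setX|].
rewrite inE /= => -[Aa0 Bb0] fmin; exists (f (a0, b0)).
  rewrite normr_gt0 subr_eq0; apply/eqP => /= a0b0.
  have : (A `&` B) a0 by split=> //; rewrite a0b0.
  by rewrite AB0.
move=> a' b' Aa' Bb'; have := fmin (a', b'); rewrite inE => /(_ (conj Aa' Bb')).
rewrite leNgt; apply: contra => /andP[n1 n2].
by rewrite {1}/f /= /Num.norm/= gt_max n1 n2.
Qed.

(** The points reachable by chains inside [A] form a nonempty subset that is open and closed in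
    [A]. *)
Lemma connected_chain delta A a b : 0 < delta -> connected A -> A a -> A b ->
  exists s, [/\ path (nearby delta) a s, last a s = b & forall z, z \in a :: s -> A z].
Proof.
move=> d0 cA Aa Ab.
pose B := [set z | exists s, [/\ path (nearby delta) a s, last a s = z
                             & forall z, z \in a :: s -> A z]].
have BA : B `<=` A by move=> z [s [_ <-]]; apply; exact: mem_last.
have Bnear z y : B z -> A y -> nearby delta z y -> B y.
  move=> [s [sa <- sA]] Ay zy; exists (rcons s y).
  rewrite rcons_path sa last_rcons; split=> // t.
  by rewrite -rcons_cons mem_rcons inE => /predU1P[->//|/sA].
suff : B = A by move=> BAE; have : B b by rewrite BAE.
apply: cA.
- by exists a, [::]; split=> // z; rewrite inE => /eqP->.
- exists (\bigcup_(z in B) (ball z delta)°).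
    by apply: bigcup_open => z _; exact: open_interior.
  apply/seteqP; split=> [z Bz|z [Az [y By /interior_subset/nearby_ball]]].
    split; first exact: BA.
    by exists z => //; apply: nbhsx_ballx.
  exact: Bnear.
- exists (~` \bigcup_(z in A `\` B) (ball z delta)°).
    by apply: open_closedC; apply: bigcup_open => z _; exact: open_interior.
  apply/seteqP; split=> [z Bz|z [Az Cz]].
    split; first exact: BA.
    move=> [y [Ay By] /interior_subset/nearby_ball]; rewrite nearby_sym => zy.
    by apply: By; exact: Bnear zy.
  apply: contrapT => Bz; apply: Cz; exists z => //.
  by apply: nbhsx_ballx.
Qed.

Lemma planar_drawable (G : sgraph) : planar G R ->
  exists2 delta : R, 0 < delta & drawable delta (@adj G).
Proof.
move=> [pos [gamma [posI ends arc novtx nocross]]].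
pose A (x y : G) : set (R * R) := gamma [set x; y]%SET @` `[0, 1]%classic.
have cA x y : adj x y -> compact (A x y) /\ connected (A x y).
  move=> /adj_edges/arc[cg _]; split.
    by apply: continuous_compact cg _; exact: segment_compact.
  by apply: connected_continuous_connected cg; exact: segment_connected.
have posA x y : adj x y -> A x y (pos x) /\ A x y (pos y).
  have i0 : (0 : R) \in `[0, 1]%R by rewrite in_itv /= lexx ler01.
  have i1 : (1 : R) \in `[0, 1]%R by rewrite in_itv /= lexx ler01.
  by move=> /ends/=[[<- <-]|[<- <-]]; split; exact: imageP.
have AP x y a : adj x y -> A x y a -> [\/ a = pos x, a = pos y |
    exists2 t, t \in `]0, 1[%R & gamma [set x; y]%SET t = a].
  move=> xy [t t01 <-]; have : (t == 0) || (t == 1) || (t \in `]0, 1[%R).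
    move: t01; rewrite /= !in_itv /= !le_eqVlt.
    by move=> /andP[/predU1P[<-|->] /predU1P[->|->]]; rewrite ?eqxx ?orbT.
  case/orP=> [/orP[]/eqP->|t01']; last by apply: Or33; exists t.
    by have /=[[-> _]|[-> _]] := ends _ _ xy; [apply: Or31|apply: Or32].
  by have /=[[_ ->]|[_ ->]] := ends _ _ xy; [apply: Or32|apply: Or31].
have disj x y z t : adj x y -> adj z t -> x != z -> x != t -> y != z ->
    y != t -> A x y `&` A z t = set0.
  move=> xy zt xz xt yz yt; apply/seteqP; split=> // a [/(AP _ _ _ xy) a1 /(AP _ _ _ zt) a2].
  have exy := adj_edges xy; have ezt := adj_edges zt.
  have ne : [set x; y]%SET != [set z; t]%SET.
    by apply/eqP => /finset.setP/(_ x); rewrite !inE eqxx (negbTE xz) (negbTE xt).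
  have ninj u v : u != v -> pos u <> pos v by move=> /eqP + /posI.
  case: a1 => [a1|a1|[s s01 a1]]; case: a2 => [a2|a2|[r r01 a2]].
  - by apply: (ninj _ _ xz); rewrite -a1.
  - by apply: (ninj _ _ xt); rewrite -a1.
  - by apply: (novtx _ ezt _ x r01); rewrite a2.
  - by apply: (ninj _ _ yz); rewrite -a1.
  - by apply: (ninj _ _ yt); rewrite -a1.
  - by apply: (novtx _ ezt _ y r01); rewrite a2.
  - by apply: (novtx _ exy _ z s01); rewrite a1.
  - by apply: (novtx _ exy _ t s01); rewrite a1.
  - by apply: (nocross _ _ exy ezt ne s r s01 r01); rewrite a1.
pose indep (q : (G * G) * (G * G)) :=
  [&& adj q.1.1 q.1.2, adj q.2.1 q.2.2, q.1.1 != q.2.1, q.1.1 != q.2.2,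
      q.1.2 != q.2.1 & q.1.2 != q.2.2].
have [delta [d0 dP]] : exists delta : R, 0 < delta /\ forall q, indep q ->
    forall a b, A q.1.1 q.1.2 a -> A q.2.1 q.2.2 b -> ~~ nearby delta a b.
  (* Each independent pair admits all sufficiently small positive [delta]; finitely many pairs share
     one. *)
  apply: (@filter_ex _ (0 : R)^'+ _ (fun delta => 0 < delta /\ _)).
  near=> d; split; first by [].
  near: d; apply: filter_forall => -[[x y] [z t]].
  have [|ni] := boolP (indep (x, y, (z, t))); last by near=> d.
  move=> /and5P[/= xy zt xz xt /andP[yz yt]].
  have [d d0 dP] := compact_far (cA _ _ xy).1 (cA _ _ zt).1 (disj _ _ _ _ xy zt xz xt yz yt).
  near=> d' => _ a b Aa Bb; apply: contra (dP a b Aa Bb) => /andP[n1 n2].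
  have d'd : d' <= d by near: d'; exact: nbhs_right_le.
  by apply/andP; split; apply: lt_le_trans d'd.
exists delta => //; exists pos.
have /choice[c cP] : forall q : G * G, exists s, adj q.1 q.2 ->
    [/\ path (nearby delta) (pos q.1) s, last (pos q.1) s = pos q.2 &
        forall a, a \in pos q.1 :: s -> A q.1 q.2 a].
  move=> [x y] /=; have [xy|_] := boolP (adj x y); last by exists [::].
  have [px py] := posA _ _ xy.
  by have [s sP] := connected_chain d0 (cA _ _ xy).2 px py; exists s.
exists (fun x y => c (x, y)); split=> [x y xy|x y z t xy zt xz xt yz yt a b aP bP].
  by have [] := cP (x, y) xy.
have [_ _ /(_ _ aP) Aa] := cP (x, y) xy; have [_ _ /(_ _ bP) Ab] := cP (z, t) zt.
by apply: (dP ((x, y), (z, t))) => //; rewrite /indep /= xy zt xz xt yz yt.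
Unshelve. all: by end_near. Qed.
End Curves.

(** * Spanning trees and edge counts *)

Lemma set2_inj (T : finType) (u w x y : T) :
  [set u; w]%SET = [set x; y]%SET -> (u = x /\ w = y) \/ (u = y /\ w = x).
Proof.
move=> /finset.setP E; move: (E u) (E w) (E x) (E y).
rewrite !inE !eqxx ?orbT /= => /esym/orP[]/eqP ? /esym/orP[]/eqP ?.
all: by move=> /orP[]/eqP ? /orP[]/eqP ?; subst; auto.
Qed.

Section SpanningTrees.
Variable G : sgraph.
Implicit Types (F : {set {set G}}) (x y : G).

Definition connecting F := [forall x, forall y, connect (adj_in F) x y].

Lemma connectingP F :
  reflect (forall x y, connect (adj_in F) x y) (connecting F).
Proof. by apply: (iffP forallP) => H x; apply/forallP. Qed.

Lemma adj_in_sym F : symmetric (adj_in F).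
Proof. by move=> x y; rewrite /adj_in finset.setUC. Qed.

(** A vertex set grown from a single vertex always has an edge of [F] leaving it. Adding the outer
    end of that edge brings in an edge not contained in the previous set. *)
Lemma connecting_card F : connecting F -> (#|G| <= #|F| + 1)%N.
Proof.
move=> /connectingP cF.
have grow k : (k < #|G|)%N -> exists2 S : {set G}, #|S| = k.+1 &
    (k <= #|[set f in F | f \subset S]|)%N.
  elim: k => [/card_gt0P[x _]|k IH kG]; first by exists [set x]; rewrite ?cards1.
  have [S cS kS] := IH (ltnW kG).
  have /card_gt0P[x xS] : (0 < #|S|)%N by rewrite cS.
  have /card_gt0P[y yS] : (0 < #|~: S|)%N by have := cardsC S; lia.
  have [/existsP[u /existsP[w /and3P[uS wS uw]]]|] := boolP
      [exists u, exists w, [&& u \in S, w \notin S & adj_in F u w]]; last first.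
    rewrite negb_exists => /forallP H.
    have /closed_connect/(_ _ _ (cF x y)) : fingraph.closed (adj_in F) S.
      apply: intro_closed => [|u w uw uS]; first exact/sym_connect_sym/adj_in_sym.
      have := H u; rewrite negb_exists => /forallP/(_ w).
      by rewrite uS uw andbT /= negbK.
    by rewrite xS => /esym; rewrite inE in yS; rewrite (negbTE yS).
  exists (w |: S); first by rewrite cardsU1 wS cS.
  rewrite (cardsD1 [set u; w]) !inE [_ \in F]uw /=.
  have -> /= : [set u; w] \subset w |: S.
    by apply/fintype.subsetP => t; rewrite !inE => /orP[]/eqP->; rewrite ?eqxx ?uS ?orbT.
  rewrite add1n ltnS; apply: leq_trans kS _.
  apply/subset_leq_card/fintype.subsetP => f; rewrite !inE.
  move=> /andP[-> fS]; rewrite (fintype.subset_trans fS (finset.subsetUr _ _)) !andbT.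
  by apply: contraTneq fS => ->; apply/fintype.subsetPn; exists w; rewrite // !inE eqxx orbT.
have [->//|G0] := posnP #|G|.
have [S _] := grow #|G|.-1 ltac:(lia).
have : (#|[set f in F | f \subset S]| <= #|F|)%N.
  by apply/subset_leq_card/fintype.subsetP => f; rewrite inE => /andP[].
by lia.
Qed.

(** A minimal connecting set is acyclic: if it had a cycle, the edge [x y] could be deleted, as the
    rest of the cycle still joins [y] to [x]. *)
Lemma spanning_tree_exists : connected_graph G -> exists F, spanning_tree F.
Proof.
move=> cG; have [|F /minsetP[/andP[FE /connectingP cF] Fmin] _] :=
  @minset_exists _ (fun F => (F \subset edges G) && connecting F) (edges G).
  rewrite subxx; apply/connectingP => x y; rewrite (eq_connect (e' := @adj G)) //.
  move=> u w; apply/idP/idP; last exact: adj_edges.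
  rewrite /adj_in inE => /existsP[a /existsP[b /andP[ab /eqP/set2_inj]]].
  by case=> [] [-> ->] //; rewrite adj_sym.
exists F; split=> // c /andP[cc uc]; rewrite ltnNge; apply/negP => c3.
case: c c3 cc uc => [|x [|y [|z s]]] // _ cc uc.
pose F' := F :\ [set x; y].
suff cF' : connecting F'.
  have /finset.setP/(_ [set x; y]) : F' = F.
    apply: Fmin; rewrite ?cF' ?andbT ?finset.subD1set //.
    exact: fintype.subset_trans (finset.subD1set _ _) FE.
  by rewrite !inE eqxx /=; case/andP: cc => + _; rewrite /adj_in => ->.
have memF' u w : adj_in F u w -> [set u; w] != [set x; y] -> adj_in F' u w.
  by rewrite /adj_in !inE => -> ->.
have yx : connect (adj_in F') y x.
  move: cc uc; rewrite /= !inE !negb_or.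
  move=> /and3P[xy yz zs] /and3P[/and3P[nxy nxz xs] /andP[nyz ys] _].
  have yz' : adj_in F' y z.
    apply: memF' => //; apply: contraNneq nxz => /set2_inj[] [].
      by move=> yx _; rewrite yx eqxx in nxy.
    by move=> _ ->.
  apply: connect_trans (connect1 yz') _.
  (* Induction moves [z] along the cycle towards [x], keeping it distinct from [x] and [y], so that
     no edge used is the deleted one. *)
  elim: s z zs xs ys nxz nyz {yz yz'} => [|w s IH] z /=.
    rewrite andbT => zx _ _ nxz nyz; apply/connect1/memF' => //.
    apply: contraNneq nyz => /set2_inj[] [-> //].
    by move=> xy'; rewrite xy' eqxx in nxy.
  move=> /andP[zw ws]; rewrite !inE !negb_or => /andP[nxw xs] /andP[nyw ys] nxz nyz.
  apply: connect_trans (IH _ ws xs ys nxw nyw).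
  apply/connect1/memF' => //; apply: contraNneq nxz => /set2_inj[] [-> //].
  by move=> wx; rewrite wx eqxx in nxw.
apply/connectingP => a b; apply: connect_sub (cF a b) => u w uw.
have [/set2_inj[] [-> ->] //|uwxy] := eqVneq [set u; w] [set x; y].
  by rewrite (sym_connect_sym (adj_in_sym F')).
exact/connect1/memF'.
Qed.

Lemma tau_gt0 : connected_graph G -> (0 < tau G)%N.
Proof.
by move=> /spanning_tree_exists[F sF]; apply/card_gt0P; exists F; apply/asboolP.
Qed.

(** Double counting of the pairs of a spanning tree and one of its edges. *)
Lemma sum_tau_edge : (#|G|.-1 * tau G <= \sum_(e in edges G) tau_edge e)%N.
Proof.
have -> : \sum_(e in edges G) tau_edge e =
    \sum_(F : {set {set G}} | `[< spanning_tree F >]) \sum_(e in edges G) (e \in F).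
  rewrite exchange_big /=; apply: eq_bigr => e _.
  by rewrite -big_mkcondr /= sum1_card.
rewrite mulnC -sum_nat_const; apply: leq_sum => F /asboolP[FE cF _].
rewrite -big_mkcondr /= sum1_card.
have -> : #|[pred e in edges G | e \in F]| = #|F|.
  apply: eq_card => e; rewrite !inE; have [/(fintype.subsetP FE)|] := boolP (e \in F).
    by rewrite inE => ->.
  by rewrite andbF.
rewrite -subn1 leq_subLR addnC; exact/connecting_card/connectingP.
Qed.

Lemma card_edges_arcs : (2 * #|edges G| <= #|arcs (@adj G)|)%N.
Proof.
rewrite -[#|arcs _|]sum1_card.
rewrite (partition_big (fun z => [set z.1; z.2]%SET) (mem (edges G))) /=; last first.
  by move=> [x y]; rewrite inE; exact: adj_edges.
rewrite mulnC -sum_nat_const; apply: leq_sum => e.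
rewrite inE => /existsP[x /existsP[y /andP[xy /eqP->]]].
rewrite sum1_card; have <- : #|[set (x, y); (y, x)]%SET| = 2.
  by rewrite cards2; case: eqP xy => // -[->]; rewrite adj_irr.
apply/subset_leq_card/fintype.subsetP => z; rewrite !inE.
case/orP=> /eqP->; apply/andP; rewrite inE /= ?xy //.
by rewrite adj_sym xy finset.setUC.
Qed.
End SpanningTrees.

(** * From densities to the edge bound *)

Local Open Scope ring_scope.
Theorem theorem3p7 (R : realType) (G : sgraph)
    (n_ge2 : (2 <= #|G|)%N)
    (G_connected : connected_graph G)
    (G_planar : planar G R) :
  1 / 3 < dep G.
Proof.
have [delta d0 dG] := planar_drawable G_planar.
have := @drawable_sparse R delta G (@adj G) [set: G]%SET d0 (@adj_sym G) (@adj_irr G).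
rewrite cardsT => /(_ (fun _ _ _ => finset.in_setT _) n_ge2 dG) sparse.
have t0 := tau_gt0 G_connected; have sum_tau := sum_tau_edge G.
have edges_arcs := card_edges_arcs G.
rewrite ltNge; apply/negP => dep_le.
have : \sum_(e in edges G) density e <= \sum_(e in edges G) (1 / 3 : rat).
  by apply: ler_sum => e eG; apply: le_trans dep_le; exact: le_bigmax_cond.
rewrite sumr_const -mulr_suml -natr_sum ler_pdivrMr ?ltr0n // => le_tau.
have : ((3 * (#|G|.-1 * tau G))%N%:R <= (#|edges G| * tau G)%N%:R :> rat).
  rewrite natrM [(#|edges G| * _)%N%:R]natrM.
  have : (#|G|.-1 * tau G)%N%:R <= (\sum_(e in edges G) tau_edge e)%N%:R :> rat.
    by rewrite ler_nat.
  by move: le_tau; rewrite -mulr_natl; lra.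
rewrite ler_nat mulnA leq_pmul2r //.
(* At least 3n - 3 edges would give at least 6n - 6 arcs, against [sparse]. *)
by lia.
Qed.
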